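(* Let $P$ be a graded poset equipped with a Morse matching $M'$ such that the family $\mathcal{R}_{M'}(P)$ of equivalence classes of rays in $\mathcal{H}_{M'}(P)$ is finite. Then there exists a rayless Morse matching $M$ on $P$ such that \[\mathcal{C}_{M}(P)=\mathcal{C}_{M'}(P)\cup \{c_{[r]}:[r]\in\mathcal{R}_{M'}(P)\},\] where $c_{[r]}\in P\smallsetminus \mathcal{C}_{M'}(P)$, $c_{[r]}\neq c_{[r']}$ for $[r]\neq[r']$, and $\deg(c_{[r]})$ equals the degree of the ray $r$.
   Context: Here $\mathbb{N}=\{0,1,2,\dots\}$. For a poset $P$ and $x\in P$ write $x\!\downarrow=\{y\in P: y\le x\}$. The length of a finite chain with $n+1$ elements is $n$. $P$ is graded if for every $x\in P$ all maximal chains in $x\!\downarrow$ are finite and have the same length, called $\deg(x)$. The Hasse diagram $\mathcal{H}(P)$ is the digraph with vertex set $P$ and an arrow from $x$ to $y$ whenever $x$ covers $y$. A matching $M$ on $\mathcal{H}(P)$ is a set of arrows no two of which share a vertex; $\mathcal{H}_M(P)$ is the digraph obtained from $\mathcal{H}(P)$ by reversing the arrows in $M$. $M$ is a Morse matching on $P$ if $\mathcal{H}_M(P)$ has no directed cycles. An element of $P$ is critical if it belongs to no arrow of $M$; $\mathcal{C}_M(P)$ is the set of critical elements. A ray in a digraph is an infinite sequence $x_0,x_1,x_2,\dots$ of pairwise distinct vertices with an arrow from $x_i$ to $x_{i+1}$ for all $i$. $M$ is rayless if $\mathcal{H}_M(P)$ contains no ray. Two rays $r,s$ are equivalent if there are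 $K,N\in\mathbb{N}$ with $r_{K+i}=s_{N+i}$ for all $i\in\mathbb{N}$; $[r]$ is the class of $r$, and $\mathcal{R}_M(P)$ is the set of equivalence classes of rays in $\mathcal{H}_M(P)$. The degree of a ray $r$ in $\mathcal{H}_M(P)$ is $\min_j\deg(r_j)$ (equivalent rays have the same degree). *)

(* Defs.v *)
From mathcomp Require Export all_boot all_order.
From mathcomp Require Export boolp classical_sets functions cardinality.

Set Implicit Arguments.
Unset Strict Implicit.
Unset Printing Implicit Defensive.

Local Open Scope order_scope.
Local Open Scope card_scope.
Open Scope classical_set_scope.

(* A digraph is given by its arrow relation: e x y means that there is an
   arrow from x to y. *)
Section Digraphs.
Context {T : choiceType}.
Implicit Types (e : rel T) (r s : nat -> T).

Definition acyclic e : Prop := forall p : seq T, p != [::] -> ~ ucycle e p.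

Definition ray e : set (nat -> T) :=
  [set r | injective r /\ forall i, e (r i) (r i.+1)].

Definition rayless e : Prop := ray e = set0.

Definition ray_equiv r s : Prop :=
  exists K N : nat, forall i : nat, r (K + i)%N = s (N + i)%N.

Definition ray_class e r : set (nat -> T) := [set s | ray e s /\ ray_equiv r s].

Definition ray_classes e : set (set (nat -> T)) := [set ray_class e r | r in ray e].

End Digraphs.

Section GradedPosets.
Context {disp : Order.disp_t} {P : porderType disp}.
Implicit Types (x y z : P) (C D : set P) (r : nat -> P) (n : nat).

Definition down x : set P := [set y | y <= x].

Definition chain C : Prop := total_on C (fun y z => y <= z).

Definition maximal_chain_in D C : Prop :=
  [/\ C `<=` D, chain C &
      forall C', C' `<=` D -> chain C' -> C `<=` C' -> C' = C].

Definition has_length C n : Prop := C #= `I_n.+1.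

Definition common_length x n : Prop :=
  forall C, maximal_chain_in (down x) C -> has_length C n.

(* By Zorn's lemma down x has a maximal chain, so there is at most one n with
   common_length x n; the default value 0 is irrelevant in a graded poset. *)
Definition deg x : nat := xget 0%N [set n | common_length x n].

Lemma deg_values_ex r : exists n, `[< exists j, deg (r j) = n >].
Proof. by exists (deg (r 0%N)); apply/asboolP; exists 0%N. Qed.

Definition ray_deg r : nat := ex_minn (deg_values_ex r).

Definition covers x y : Prop := y < x /\ forall z, ~ (y < z /\ z < x).

Definition hasse : rel P := fun x y => `[< covers x y >].

End GradedPosets.

Definition graded {disp : Order.disp_t} (P : porderType disp) : Prop :=
  forall x : P, exists n : nat, common_length x n.

(* The pair (x, y) stands for the arrow from x to y. *)
Section Matchings.
Context {disp : Order.disp_t} {P : porderType disp}.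
Implicit Types (M : set (P * P)) (a b : P * P).

Definition vertices a : set P := [set a.1; a.2].

Definition matching M : Prop :=
  (forall a, M a -> hasse a.1 a.2) /\
  (forall a b, M a -> M b -> a <> b -> vertices a `&` vertices b = set0).

Definition hasse_rev M : rel P := fun x y =>
  (hasse x y && ((x, y) \notin M)) || ((y, x) \in M).

Definition morse_matching M : Prop := matching M /\ acyclic (hasse_rev M).

Definition critical M : set P := [set x | forall a, M a -> ~ vertices a x].

End Matchings.

(* Main.v *)
Require Import Defs.
From mathcomp Require Import zify.

(** A ray that starts at its lowest degree alternates: from a vertex of minimal
    degree the only possible arrow is a matched one, going up, and two matched
    arrows cannot follow each other, so the next one goes down to the minimal
    degree again ([low_walk]).  Such a ray
    [y0 -> x0 -> y1 -> x1 -> ...] uses the matched pairs [(x_i, y_i)].  Matching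
    [x_i] with [y_(i+1)] instead reverses the ray: it now runs down to [y0],
    which becomes critical and has the degree of the ray.  This is done
    simultaneously on one representative of every class of rays.

    The representatives must be chosen far enough along their rays for the
    reversal not to create cycles or rays.  The point is that every ray has
    a tail with no detour: an arrow leaving the tail never leads back to it
    ([ray_unavoidable_tail]).  Otherwise the ray would have infinitely many
    detours, and by taking or skipping each of them one could build a ray that
    disagrees infinitely often with a representative of each of the finitely many
    classes ([diagonal_walk]).  From the absence of detours, two rays each of
    which keeps reaching the other are equivalent ([flows_antisym]).  Hence
    being able to go from one class to another arbitrarily late is a partial
    order on the finite set of classes; it has a rank function, and, for late
    enough tails, any path from one representative to another one lowers the rank
    ([representative_rays_ex]).

    Cycles and rays of the new digraph both give infinite walks, so it suffices
    to exclude these.  An infinite walk may be taken to alternate.  It must use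
    reversed arrows again and again, since otherwise a tail of it would be an old
    ray, hence would follow some representative.  Between two such uses it
    either moves one step down along a reversed ray, or leaves that ray by an old
    arrow and reaches a representative; as there are no detours this is another
    one, of smaller rank ([leave_reversed_ray]).  So the pair formed by the rank
    and the position on the ray decreases lexicographically, forever, which is
    absurd. *)

Set Implicit Arguments.
Unset Strict Implicit.
Unset Printing Implicit Defensive.

Import Order.POrderTheory.

(** * Infinite walks and reachability *)
Section Walks.
Context {T : choiceType}.
Implicit Types (e : rel T) (w r s : nat -> T) (x y z : T).

Definition walk e w : Prop := forall i, e (w i) (w i.+1).

Definition reach e x y : Prop := exists2 p, path e x p & last x p = y.

Lemma reach_refl e x : reach e x x. Proof. by exists [::]. Qed.

Lemma reach_trans e x y z : reach e x y -> reach e y z -> reach e x z.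
Proof.
move=> [p ep <-] [q eq <-]; exists (p ++ q); last by rewrite last_cat.
by rewrite cat_path ep.
Qed.

Lemma reach1 e x y : e x y -> reach e x y.
Proof. by move=> exy; exists [:: y] => //=; rewrite exy. Qed.

Lemma walk_reach e w i j : walk e w -> i <= j -> reach e (w i) (w j).
Proof.
move=> ew /subnKC <-; elim: (j - i) => [|k IH]; first by rewrite addn0; exact: reach_refl.
by rewrite addnS; apply: reach_trans IH (reach1 (ew _)).
Qed.

Lemma walk_shift e w k : walk e w -> walk e (fun i => w (k + i)).
Proof. by move=> ew i; rewrite addnS; apply: ew. Qed.

(** Acyclicity only speaks of cycles without repetition, so the return path is
    first shortened. *)
Lemma acyclic_no_return e x y : acyclic e -> e x y -> ~ reach e y x.
Proof.
move=> ac exy [p yp]; case: (shortenP yp) => q yq uq _ qx.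
by apply: (ac (y :: q)) => //; rewrite /ucycle /= rcons_path yq qx exy.
Qed.

Lemma walk_inj e w : acyclic e -> walk e w -> injective w.
Proof.
move=> ac ew i j wij; wlog ltij : i j wij / i < j.
  by move=> H; case: (ltngtP i j) => // ij; [apply: H | apply/esym/H].
case: (acyclic_no_return ac (ew i)); rewrite wij; exact: walk_reach.
Qed.

Lemma no_walk_acyclic e : (forall w, ~ walk e w) -> acyclic e.
Proof.
move=> nw [//|x p] _ /andP[cp _].
have inp i : iter i (next (x :: p)) x \in x :: p.
  by elim: i => [|i IH]; [exact: mem_head | rewrite iterS mem_next].
by apply: (nw (fun i => iter i (next (x :: p)) x)) => i; exact: next_cycle cp (inp i).
Qed.

Lemma no_walk_rayless e : (forall w, ~ walk e w) -> rayless e.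
Proof. by move=> nw; rewrite /rayless -subset0 => w [_ /nw]. Qed.

Lemma ray_equiv_refl r : ray_equiv r r.
Proof. by exists 0, 0. Qed.

Lemma ray_equiv_sym r s : ray_equiv r s -> ray_equiv s r.
Proof. by move=> [K [N rs]]; exists N, K => i; rewrite rs. Qed.

Lemma ray_equiv_trans r s t : ray_equiv r s -> ray_equiv s t -> ray_equiv r t.
Proof.
move=> [K [N rs]] [K' [N' st]]; exists (K + K'), (N' + N) => i.
by rewrite -addnA rs addnCA st addnA.
Qed.

Lemma ray_equiv_shift r k : ray_equiv r (fun i => r (k + i)).
Proof. by exists k, 0. Qed.

Lemma ray_class_equiv e r s : ray_equiv r s -> ray_class e r = ray_class e s.
Proof.
move=> rs; apply/seteqP; split=> t [et rt]; split=> //.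
  exact: ray_equiv_trans (ray_equiv_sym rs) rt.
exact: ray_equiv_trans rs rt.
Qed.

(** The predicate [E n] is meant to hold of the arrows used by the [n]-th
    element of a list of walks; the walk obtained escapes all of them.  It is the
    concatenation, over [n], of finite paths whose last arrow avoids [E n]. *)
Lemma diagonal_walk e (G : set T) (E : nat -> T -> T -> Prop) (v0 : T) :
  G v0 ->
  (forall n v, G v -> exists a b, [/\ reach e v a, e a b, G b & ~ E n a b]) ->
  exists w, walk e w /\ forall n, exists2 i, n <= i & ~ E n (w i) (w i.+1).
Proof.
move=> Gv0 ext.
pose good (n : nat) (v : T) (s : seq T * T) :=
  [/\ path e v s.1, e (last v s.1) s.2, G s.2 & ~ E n (last v s.1) s.2].
have /choice[seg segP] : forall nv : nat * T, exists s : seq T * T,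
    G nv.2 -> good nv.1 nv.2 s.
  move=> [n v] /=; have [Gv|nG] := pselect (G v); last by exists ([::], v).
  have [a [b [[p vp <-] eab Gb nE]]] := ext n _ Gv.
  by exists (p, b).
(* A state consists of the stage, the current vertex, and what remains to be
   travelled: a path and the final arrow that avoids the stage's relation. *)
pose step (st : nat * T * (seq T * T)) :=
  match st with
  | (n, _, (y :: q, b)) => (n, y, (q, b))
  | (n, _, ([::], b)) => (n.+1, b, seg (n.+1, b))
  end.
pose st i := iter i step (0, v0, seg (0, v0)).
pose w i := (st i).1.2.
have inv i : good (st i).1.1 (w i) (st i).2.
  rewrite /w; elim: i => [|i]; first exact: (segP (0, v0)).
  rewrite /st iterS -/(st i); case: (st i) => [[n x] [[|y q] b]] /= [].
    by move=> _ _ /= Gb _; apply: (segP (n.+1, b)).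
  by move=> /= /andP[_ yq] eb Gb nE.
have next i : st i.+1 = step (st i) by [].
exists w; split=> [i|].
  move: (inv i); rewrite /w next; case: (st i) => [[n x] [[|y q] b]] [] //=.
  by case/andP.
have flush q : forall i n x b, st i = (n, x, (q, b)) ->
    exists2 j, i <= j & exists2 y, st j = (n, y, ([::], b)) & ~ E n (w j) b.
  elim: q => [|y q IH] i n x b sti.
    exists i => //; exists x => //; have := inv i; rewrite sti /w sti.
    by case.
  have [|j ij H] := IH i.+1 n y b; first by rewrite next sti.
  by exists j => //; lia.
have visit n : exists i x (s : seq T * T), [/\ n <= i & st i = (n, x, s)].
  elim: n => [|n [i [x [[q b] [ni sti]]]]]; first by exists 0, v0, (seg (0, v0)).
  have [j ij [y stj _]] := flush _ _ _ _ _ sti.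
  by exists j.+1, b, (seg (n.+1, b)); split; [lia | rewrite next stj].
move=> n; have [i [x [[q b] [ni sti]]]] := visit n.
have [j ij [y stj nE]] := flush _ _ _ _ _ sti.
by exists j; [lia | rewrite {2}/w next stj].
Qed.

(** The absence of detours: a path that leaves [r] never comes back to it. *)
Definition unavoidable e r : Prop :=
  forall i z k, e (r i) z -> reach e z (r k) -> z = r i.+1.

(** If there were detours arbitrarily far along [r], then at each of them one of
    the two continuations, along [r] or along the detour, would differ from that
    of a prescribed ray.  Prescribing representatives of all the classes in turn,
    each infinitely often, would give a ray in no class. *)
Lemma ray_unavoidable_tail e r : acyclic e -> finite_set (ray_classes e) ->
  walk e r -> exists N, unavoidable e (fun i => r (N + i)).
Proof.
move=> ac /finite_seqP[cs csE] er.
have [[N HN]|nH] := pselect (exists N, forall i z k, N <= i -> e (r i) z ->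
    reach e z (r k) -> z = r i.+1).
  exists N => i z k /= eiz zk; rewrite addnS; apply: HN zk => //; lia.
have detour N : exists i z k, [/\ N <= i, e (r i) z, reach e z (r k) & z <> r i.+1].
  apply: contrapT => H; apply: nH; exists N => i z k Ni ez zk.
  by apply: contrapT => zr; apply: H; exists i, z, k.
pose rep c : nat -> T := xget r [set s | ray e s /\ c = ray_class e s].
have repP c : c \in cs -> ray e (rep c) /\ c = ray_class e (rep c).
  move=> cin; have : ray_classes e c by rewrite csE.
  by move=> [s rs cE]; apply: (@xgetPex _ r [set s | ray e s /\ c = ray_class e s]); exists s.
have rep_inj c : injective (rep c).
  rewrite /rep; case: xgetP => [s -> [[]//]|_]; exact: walk_inj ac er.
(* The representatives are repeated cyclically, so that each of them occurs
   arbitrarily late. *)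
pose rho n := rep (nth set0 cs (n %% size cs)).
have [||w [ew wE]] := @diagonal_walk e [set v | exists k, reach e v (r k)]
   (fun n a b => exists j, rho n j = a /\ rho n j.+1 = b) (r 0).
- by exists 0; exact: reach_refl.
- move=> n v [k vk]; have [i [z [l [ki ez zl zr]]]] := detour k.
  have vi : reach e v (r i) by apply: reach_trans vk (walk_reach er ki).
  have [[j [ja jb]]|nE] := pselect (exists j, rho n j = r i /\ rho n j.+1 = r i.+1).
    exists (r i), z; split=> //; first by exists l.
    move=> [j' [ja' jb']]; apply: zr; rewrite -jb' -jb; congr (rho n _.+1).
    exact: rep_inj (etrans ja' (esym ja)).
  by exists (r i), (r i.+1); split=> //; exists i.+1; exact: reach_refl.
have rw : ray e w by split=> //; exact: walk_inj ac ew.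
have cin : ray_class e w \in cs.
  have : ray_classes e (ray_class e w) by exists w.
  by rewrite csE.
have [_ wc] := repP _ cin.
have [_ [K [N KN]]] : ray_class e (rep (ray_class e w)) w.
  by rewrite -wc; split=> //; exact: ray_equiv_refl.
(* A stage later than [N], at which the class of [w] itself was to be escaped. *)
pose n := index (ray_class e w) cs + N * size cs.
have ltn : index (ray_class e w) cs < size cs by rewrite index_mem.
have rhon : rho n = rep (ray_class e w).
  by rewrite /rho /n addnC modnMDl modn_small // nth_index.
have [i ni []] := wE n; exists (K + (i - N)).
have Ni : N <= i.
  apply: leq_trans ni; rewrite /n; have := leq_pmulr N (leq_ltn_trans (leq0n _) ltn); lia.
rewrite rhon -addnS !KN addnS subnKC //.
Qed.

Lemma unavoidable_between e r v i k : unavoidable e r ->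
  reach e (r i) v -> reach e v (r k) -> exists2 j, i <= j & r j = v.
Proof.
move=> ur [p + <-]; elim: p i => [|z p IH] i /=; first by exists i.
move=> /andP[ez zp] lk.
have zE : z = r i.+1 by apply: ur ez _; apply: reach_trans lk; exists p.
move: zp lk; rewrite zE => zp lk; have [j ij <-] := IH _ zp lk; exists j => //; lia.
Qed.

Lemma unavoidable_shift e r k : unavoidable e r -> unavoidable e (fun i => r (k + i)).
Proof. by move=> ur i z j; rewrite addnS; apply: ur. Qed.

(** When [s] is a walk this says that [s] can be reached arbitrarily late from
    arbitrarily late points of [r], as reaching [s j] entails reaching what
    follows. *)
Definition flows e r s : Prop := forall i, exists j, reach e (r i) (s j).

Lemma flows_refl e r : flows e r r.
Proof. by move=> i; exists i; exact: reach_refl. Qed.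

Lemma flows_trans e r s t : flows e r s -> flows e s t -> flows e r t.
Proof.
by move=> rs st i; have [j ij] := rs i; have [k jk] := st j; exists k; apply: reach_trans ij jk.
Qed.

(** Every late vertex of [s] lies between two vertices of [r], hence on [r]; and
    consecutive ones are consecutive on [r], since [r] has no detour. *)
Lemma flows_antisym e r s : walk e s -> unavoidable e r ->
  flows e r s -> flows e s r -> ray_equiv r s.
Proof.
move=> es ur rs sr; have [j0 rj0] := rs 0.
have on j : j0 <= j -> exists i, r i = s j.
  move=> jj; have [k jk] := sr j.
  have r0j : reach e (r 0) (s j) by apply: reach_trans rj0 (walk_reach es jj).
  by have [i _ iE] := unavoidable_between ur r0j jk; exists i.
have [i0 i0E] := on j0 (leqnn _).
exists i0, j0; elim=> [|n IH]; first by rewrite !addn0.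
rewrite !addnS; apply/esym; have [k kE] := on (j0 + n).+1 ltac:(lia).
apply: (ur _ _ k); first by rewrite IH.
rewrite kE; exact: reach_refl.
Qed.

End Walks.

Lemma uniform_bound (I : eqType) (s : seq I) (Q : I -> nat -> Prop) :
  (forall i, exists N, forall n, N <= n -> Q i n) ->
  exists N, forall i n, i \in s -> N <= n -> Q i n.
Proof.
move=> H; elim: s => [|i s [N HN]]; first by exists 0.
have [N' HN'] := H i; exists (maxn N N') => j n.
rewrite inE geq_max => /orP[/eqP -> /andP[_ /HN']//|js /andP[/HN nN _]].
exact: nN.
Qed.

Lemma ltn_count (I : eqType) (a b : pred I) (s : seq I) x :
  subpred a b -> x \in s -> b x -> ~~ a x -> count a s < count b s.
Proof.
move=> ab xs bx nax; have := count_predUI a (pred1 x) s.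
rewrite (_ : count (predI _ _) s = 0); last first.
  by apply/eqP; rewrite -leqn0 leqNgt -has_count; apply/hasPn => y _ /=;
     apply/negP => /andP[ay /eqP yx]; rewrite -yx ay in nax.
have : 0 < count (pred1 x) s by rewrite -has_count has_pred1.
have : count (predU a (pred1 x)) s <= count b s.
  by apply: sub_count => y /= /orP[/ab|/eqP ->].
by lia.
Qed.

(** The number of [j] with [R i j] is a rank. *)
Lemma finite_order_rank (I : eqType) (s : seq I) (R : I -> I -> Prop) :
  (forall i, i \in s) -> (forall i, R i i) ->
  (forall i j k, R i j -> R j k -> R i k) ->
  (forall i j, R i j -> R j i -> i = j) ->
  exists rank : I -> nat, forall i j, R i j -> i = j \/ rank j < rank i.
Proof.
move=> sT refl trans asym.
exists (fun i => count (fun j => `[< R i j >]) s) => i j ij.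
have [->|nij] := pselect (i = j); [by left | right].
apply: (@ltn_count _ _ _ _ i) => //; last first.
- by apply/asboolPn => ji; apply: nij; apply: asym.
- exact/asboolP.
- by move=> k /asboolP jk; apply/asboolP; apply: trans ij jk.
Qed.

(** * Degrees in graded posets *)
Section Degree.
Context {disp : Order.disp_t} {P : porderType disp}.
Implicit Types (x y z : P) (C D : set P).

Lemma maximal_chain_ex D : exists C, maximal_chain_in D C.
Proof.
have [F FS tF|C [[CD chC] Cmax]] := @Zorn_bigcup P [set C | C `<=` D /\ chain C].
  split; first by move=> y [X FX Xy]; exact: (FS _ FX).1.
  move=> y z [X FX Xy] [Y FY Yz].
  have [XY|YX] := tF _ _ FX FY.
    by apply: (FS _ FY).2 => //; exact: XY.
  by apply: (FS _ FX).2 => //; exact: YX.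
exists C; split=> // C' C'D chC' CC'; apply: contrapT => nC; apply: (Cmax C') => //.
by split=> // C'C; apply: nC; apply/seteqP.
Qed.

Lemma hasse_lt x y : hasse x y -> (y < x)%O.
Proof. by move=> /asboolP[]. Qed.

Hypothesis hP : graded P.

Lemma common_length_deg x : common_length x (deg x).
Proof. by have [n xn] := hP x; apply: (@xgetPex _ 0 [set n | common_length x n]); exists n. Qed.

(** Adding [x] to a maximal chain below [y] gives a maximal chain below [x]: the
    former contains [y], so any further element would lie strictly between [y]
    and [x]. *)
Lemma deg_hasse x y : hasse x y -> deg x = (deg y).+1.
Proof.
move=> /asboolP[yx cov].
have [C mC] := maximal_chain_ex (down y).
have [Cy chC Cmax] := mC.
have Cyy : C y.
  suff <- : y |` C = C by left.
  apply: Cmax => //.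
  - by move=> z [->|/Cy//]; exact: lexx.
  - move=> u v [->|Cu] [->|Cv]; first by left.
    + by right; exact: Cy.
    + by left; exact: Cy.
    + exact: chC.
have nCx : ~ C x by move=> /Cy /(lt_le_trans yx); rewrite ltxx.
have mD : maximal_chain_in (down x) (x |` C).
  split.
  - move=> z [->|/Cy zy]; [exact: lexx | exact: le_trans zy (ltW yx)].
  - move=> u v [->|Cu] [->|Cv]; first by left.
    + by right; apply: le_trans (Cy _ Cv) (ltW yx).
    + by left; apply: le_trans (Cy _ Cu) (ltW yx).
    + exact: chC.
  move=> C' C'x chC' CC'; rewrite -(Cmax (C' `\ x)).
  - by rewrite setD1K //; apply: CC'; left.
  - move=> z [C'z zx]; have [//|yz] := chC' _ _ C'z (CC' _ (or_intror Cyy)).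
    have [->|yz'] := eqVneq y z; first exact: lexx.
    case: (cov z); rewrite lt_neqAle yz' yz lt_neqAle; split=> //.
    by rewrite (C'x _ C'z) andbT; apply/eqP.
  - by move=> u v [C'u _] [C'v _]; exact: chC'.
  - move=> z Cz; split; first by apply: CC'; right.
    by move=> zx; apply: nCx; rewrite -zx.
have Cn := common_length_deg mC.
have Dn : has_length (x |` C) (deg y).+1.
  apply/eq_cardSP; exists x; first by left.
  by rewrite setUKD // => z [-> /nCx].
have := card_eq_trans (card_esym (common_length_deg mD)) Dn.
by move/card_eq_II => [].
Qed.

End Degree.

(** * Walks along a matching *)
Section MatchingFacts.
Context {disp : Order.disp_t} {P : porderType disp}.
Variable M : set (P * P).
Implicit Types (x y z : P) (w r s : nat -> P).

Lemma hasse_revP x y :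
  reflect ((hasse x y /\ ~ M (x, y)) \/ M (y, x)) (hasse_rev M x y).
Proof.
rewrite /hasse_rev; apply: (iffP orP) => -[].
- by move=> /andP[xy nM]; left; split=> // Mxy; rewrite mem_set in nM.
- by move=> /set_mem; right.
- by move=> [-> nM]; left; apply/negP => /set_mem.
- by move=> /mem_set; right.
Qed.

Lemma matching_eq a b v :
  matching M -> M a -> M b -> vertices a v -> vertices b v -> a = b.
Proof.
move=> [_ Mdis] Ma Mb av bv; apply: contrapT => ab.
have : (vertices a `&` vertices b) v by [].
by rewrite (Mdis _ _ Ma Mb ab).
Qed.

Lemma matching_of_shared_vertex : (forall a, M a -> hasse a.1 a.2) ->
  (forall a b v, M a -> M b -> vertices a v -> vertices b v -> a = b) -> matching M.
Proof.
move=> Mh Meq; split=> // a b Ma Mb ab; rewrite -subset0 => v [av bv].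
exact: ab (Meq _ _ _ Ma Mb av bv).
Qed.

Lemma matching_no_up_up x y z : matching M -> M (y, x) -> ~ M (z, y).
Proof.
move=> hM Myx Mzy.
have [_ xy] : (y, x) = (z, y).
  by apply: (matching_eq hM Myx Mzy); [left | right].
by have := hasse_lt (hM.1 _ Myx); rewrite /= xy ltxx.
Qed.

Lemma ray_degP r : (exists j, deg (r j) = ray_deg r) /\ forall i, ray_deg r <= deg (r i).
Proof.
rewrite /ray_deg; case: ex_minnP => m /asboolP[j jm] min; split; first by exists j.
by move=> i; apply: min; apply/asboolP; exists i.
Qed.

(** Rays are normalised to start at a vertex of minimal degree. *)
Definition low w : Prop := forall i, deg (w 0) <= deg (w i).

Lemma low_shift_ex w : exists j, low (fun i => w (j + i)) /\ deg (w j) = ray_deg w.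
Proof.
by have [[j jE] min] := ray_degP w; exists j; split=> // i; rewrite addn0 jE.
Qed.

Hypotheses (hP : graded P) (hM : matching M).

(** At a vertex of minimal degree the next arrow cannot go down, so it is a
    reversed one; the one after it cannot be reversed too, so it goes down, and
    the degree is minimal again. *)
Lemma low_walk w i : walk (hasse_rev M) w -> low w ->
  [/\ deg (w i.*2) = deg (w 0), M (w i.*2.+1, w i.*2),
      hasse (w i.*2.+1) (w i.*2.+2) & ~ M (w i.*2.+1, w i.*2.+2)].
Proof.
move=> ew lw.
have step k : deg (w k) = deg (w 0) -> [/\ M (w k.+1, w k),
    hasse (w k.+1) (w k.+2) & ~ M (w k.+1, w k.+2)].
  move=> dk; have [[kk _]|up] := hasse_revP _ _ (ew k).
    by have := lw k.+1; rewrite -dk (deg_hasse hP kk) ltnn.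
  split=> //; have [[]//|up2] := hasse_revP _ _ (ew k.+1);
    by case: (matching_no_up_up hM up up2).
suff di : deg (w i.*2) = deg (w 0) by have [] := step _ di.
elim: i => [//|i IH]; have [up dn _] := step _ IH.
rewrite doubleS; have := deg_hasse hP dn.
by rewrite (deg_hasse hP (hM.1 _ up)) /= IH => -[].
Qed.

Lemma low_shift w k : walk (hasse_rev M) w -> low w -> low (fun i => w (k.*2 + i)).
Proof. by move=> ew lw i; rewrite addn0; have [-> _ _ _] := low_walk k ew lw. Qed.

(** The minimal degree recurs every second step, so it is attained on every
    tail. *)
Lemma ray_deg_equiv r s : walk (hasse_rev M) r -> walk (hasse_rev M) s ->
  ray_equiv r s -> ray_deg r = ray_deg s.
Proof.
have le r' s' : walk (hasse_rev M) r' -> ray_equiv r' s' -> ray_deg s' <= ray_deg r'.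
  move=> er [K [N rs]]; have [j [jl <-]] := low_shift_ex r'.
  have [+ _ _ _] := low_walk K (walk_shift j er) jl.
  rewrite addn0 => <-; rewrite (_ : j + K.*2 = K + (j + K)); last by lia.
  by rewrite rs; apply: (ray_degP s').2.
move=> er es rs; apply/eqP; rewrite eqn_leq !le //; exact: ray_equiv_sym.
Qed.

End MatchingFacts.

(** * Reversing the rays *)
Section Reversal.
Context {disp : Order.disp_t} {P : porderType disp}.
Variables (M : set (P * P)) (I : Type) (rho : I -> nat -> P) (rank : I -> nat).
Notation e := (hasse_rev M).
Implicit Types (R S : I) (i j k l : nat) (w : nat -> P) (a b : P * P).

(** The even-indexed vertices of a representative [rho R] have the minimal
    degree; their matched partner is moved from the following vertex to the
    preceding one. *)
Definition reversal : set (P * P) :=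
  [set a | M a /\ forall R i, a <> (rho R i.*2.+1, rho R i.*2)] `|`
  [set a | exists R i, a = (rho R i.*2.+1, rho R i.*2.+2)].

Hypotheses (hP : graded P) (hM : matching M) (hac : acyclic e).
Hypothesis rho_walk : forall R, walk e (rho R).
Hypothesis rho_low : forall R, low (rho R).
Hypothesis rho_unavoidable : forall R, unavoidable e (rho R).
Hypothesis rho_rank : forall R S i j,
  reach e (rho R i) (rho S j) -> R = S \/ rank S < rank R.
Hypothesis rho_all : forall w, walk e w -> exists R, ray_equiv w (rho R).

Lemma rho_match R i : M (rho R i.*2.+1, rho R i.*2).
Proof. by have [] := low_walk hP hM i (rho_walk R) (rho_low R). Qed.

Lemma rho_down R i : hasse (rho R i.*2.+1) (rho R i.*2.+2).
Proof. by have [] := low_walk hP hM i (rho_walk R) (rho_low R). Qed.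

(** A common vertex would let each of two representatives reach the other, so
    the rank of each would be below that of the other. *)
Lemma rho_eq R S i j : rho R i = rho S j -> R = S /\ i = j.
Proof.
move=> RS; have ij : R = S.
  have RS' : reach e (rho R i) (rho S j) by rewrite RS; exact: reach_refl.
  have SR' : reach e (rho S j) (rho R i) by rewrite RS; exact: reach_refl.
  have [//|SR] := rho_rank RS'; have [//|] := rho_rank SR'.
  by move=> /(ltn_trans SR); rewrite ltnn.
by rewrite -ij in RS *; split=> //; apply: walk_inj (rho_walk R) _ _ RS.
Qed.

Lemma rho_vertex R i : vertices (rho R i./2.*2.+1, rho R i./2.*2) (rho R i).
Proof.
by rewrite -[in X in vertices _ X](odd_double_half i); case: odd; [left | right].
Qed.

Lemma rho_matched R i : exists a, M a /\ vertices a (rho R i).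
Proof.
exists (rho R i./2.*2.+1, rho R i./2.*2).
by split; [exact: rho_match | exact: rho_vertex].
Qed.

(** All vertices of the representatives are covered by removed arrows. *)
Lemma kept_off_rho a R i :
  M a -> (forall S j, a <> (rho S j.*2.+1, rho S j.*2)) -> ~ vertices a (rho R i).
Proof.
move=> Ma off av; apply: (off R i./2).
apply: (matching_eq hM Ma (rho_match R i./2) av).
exact: rho_vertex.
Qed.

Lemma reversal_matching : matching reversal.
Proof.
apply: matching_of_shared_vertex => [a [[/hM.1//]|[R [i ->]]]|]; first exact: rho_down.
move=> a b v [[Ma aoff]|[R [i ->]]] [[Mb boff]|[S [j ->]]] av bv.
- exact: matching_eq hM Ma Mb av bv.
- by case: bv => vE; rewrite vE in av; case: (kept_off_rho Ma aoff av).
- by case: av => vE; rewrite vE in bv; case: (kept_off_rho Mb boff bv).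
- have [-> ij] : R = S /\ i = j; last by rewrite ij.
  by case: av bv => /= -> [] /= /rho_eq[]; split=> //; lia.
Qed.

Lemma reversal_critical :
  critical reversal = critical M `|` range (fun R => rho R 0).
Proof.
apply/seteqP; split=> v.
  move=> cv; have [?|nc] := pselect (critical M v); [by left | right].
  have [a [Ma av]] : exists a, M a /\ vertices a v.
    by apply: contrapT => H; apply: nc => a Ma av; apply: H; exists a.
  have [[R [i aE]]|off] := pselect (exists R i, a = (rho R i.*2.+1, rho R i.*2)); last first.
    case: (cv a) => //; left; split=> // R i aE; apply: off; by exists R, i.
  move: av; rewrite aE => -[]/= vE.
    by case: (cv (rho R i.*2.+1, rho R i.*2.+2)); [right; exists R, i | left].
  case: i vE {aE} => [|i] vE; first by exists R.
  by case: (cv (rho R i.*2.+1, rho R i.*2.+2)); [right; exists R, i | right].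
move=> [cv|[R _ <-]] a [[Ma off]|[S [i ->]]].
- exact: cv.
- move=> av; have [b [Mb bv]] : exists b, M b /\ vertices b v.
    by case: av => /= ->; exact: rho_matched.
  exact: (cv b).
- exact: kept_off_rho.
- by case=> /rho_eq[].
Qed.

(** The first arrow of [w] is the reversal of the new pair of index [k] on
    [rho R]. *)
Definition starts_reversed w R k := w 0 = rho R k.*2.+2 /\ w 1 = rho R k.*2.+1.

(** As long as the walk uses kept pairs it is a walk of the original digraph.  If
    it did so forever, it would follow a representative [rho R] eventually; but
    the kept pairs avoid the representatives. *)
Lemma low_walk_hits_reversed w : walk (hasse_rev reversal) w -> low w ->
  exists i R k, reach e (w 0) (w i.*2) /\ starts_reversed (fun j => w (i.*2 + j)) R k.
Proof.
move=> ew lw.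
pose new i := `[< exists R k, (w i.*2.+1, w i.*2) = (rho R k.*2.+1, rho R k.*2.+2) >].
have alt i := low_walk hP reversal_matching i ew lw.
have kept i : ~~ new i -> e (w i.*2) (w i.*2.+1) /\ e (w i.*2.+1) (w i.*2.+2).
  move=> /asboolPn ni; have [_ up dn ndn] := alt i.
  case: (up) => [[Mup off]|[R [k E]]]; last by case: ni; exists R, k.
  split; apply/hasse_revP; first by right.
  left; split=> // Mdn; apply: ndn.
  have wE : (w i.*2.+1, w i.*2) = (w i.*2.+1, w i.*2.+2).
    by apply: (matching_eq hM Mup Mdn); left.
  by rewrite -wE.
have [[i0 newi]|nonew] := pselect (exists i, new i); last first.
  have ew' : walk e w.
    move=> i; rewrite -(odd_double_half i).
    have [|e1 e2] := kept i./2; first by apply/negP => ni; apply: nonew; exists i./2.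
    by case: odd.
  have [R [K [N KN]]] := rho_all ew'.
  have [_ [[Mup off]|[R' [k E]]] _ _] := alt K; last first.
    by case: nonew; exists K; apply/asboolP; exists R', k.
  case: (kept_off_rho (R := R) (i := N + K) Mup off); right => /=.
  by rewrite -KN addnn.
case: (ex_minnP (ex_intro new i0 newi)) => i /asboolP[R [k [w1 w0]]] min.
exists i, R, k; split; last by rewrite /starts_reversed addn0 addn1.
have: forall j, j <= i -> reach e (w 0) (w j.*2); last exact.
elim=> [|j IH] ji; first exact: reach_refl.
have [|e1 e2] := kept j; first by apply/negP => /min; rewrite leqNgt ji.
apply: reach_trans (IH (ltnW ji)) (reach_trans (reach1 e1) (reach1 e2)).
Qed.

(** At [rho R k.*2.+1] the reversed ray goes on to [rho R k.*2].  Any other arrow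
    is an old one, and is followed by an old path to some representative; this
    cannot be [rho R] itself, which has no detour. *)
Lemma leave_reversed_ray w R k : walk (hasse_rev reversal) w -> low w -> starts_reversed w R k ->
  w 2 = rho R k.*2 \/
  exists i S l, rank S < rank R /\ starts_reversed (fun j => w (2 + i.*2 + j)) S l.
Proof.
move=> ew lw [w0 w1].
have [_ _ dn ndn] := low_walk hP reversal_matching 0 ew lw.
have [Mdn|nMdn] := pselect (M (w 1, w 2)); [left | right].
  rewrite w1 in Mdn.
  by have [] : (rho R k.*2.+1, w 2) = (rho R k.*2.+1, rho R k.*2);
    first by apply: (matching_eq hM Mdn (rho_match R k)); left.
have [i [S [l [wi new]]]] := low_walk_hits_reversed (walk_shift 2 ew)
  (low_shift hP reversal_matching 1 ew lw).
exists i, S, l; split; last first.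
  by move: new; rewrite /starts_reversed !addnA.
have ewi : e (rho R k.*2.+1) (w 2) by rewrite -w1; apply/hasse_revP; left.
have [new0 _] := new; rewrite addn0 in new0; rewrite /= new0 in wi.
have [RS|//] := rho_rank (reach_trans (reach1 ewi) wi).
case: ndn; right; exists R, k; rewrite -RS in wi.
by rewrite /= w1 (rho_unavoidable ewi wi).
Qed.

(** Induction on the rank of [R], then on [k]: the walk either moves to a
    representative of smaller rank, or down along [rho R], where it is stopped
    by the critical vertex [rho R 0]. *)
Lemma no_walk_starting_reversed w R k :
  walk (hasse_rev reversal) w -> low w -> ~ starts_reversed w R k.
Proof.
have [n] := ubnP (rank R); elim: n w R k => [//|n IHn] w R k Rn.
elim: k w => [|k IHk] w ew lw wR.
all: have [w2|[i [S [l [SR]]]]] := leave_reversed_ray ew lw wR; last first.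
1,3: apply: IHn; [lia | exact: walk_shift |].
1,2: exact: (low_shift hP reversal_matching i.+1).
all: have [_ up2 _ _] := low_walk hP reversal_matching 1 ew lw.
  have : critical reversal (rho R 0) by rewrite reversal_critical; right; exists R.
  by move=> /(_ _ up2); apply; right.
apply: (IHk (fun i => w (2 + i))).
- exact: walk_shift.
- exact: (low_shift hP reversal_matching 1).
split; first by rewrite addn0 w2.
have newk : reversal (rho R k.*2.+1, rho R k.*2.+2) by right; exists R, k.
by have [] : (w 3, w 2) = (rho R k.*2.+1, rho R k.*2.+2);
  first by apply: (matching_eq reversal_matching up2 newk); right.
Qed.

Lemma reversal_no_walk w : ~ walk (hasse_rev reversal) w.
Proof.
move=> ew; have [j [jl _]] := low_shift_ex w.
have [i [R [k [_ new]]]] := low_walk_hits_reversed (walk_shift j ew) jl.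
apply: no_walk_starting_reversed new; first exact: (walk_shift i.*2 (walk_shift j ew)).
exact: (low_shift hP reversal_matching i (walk_shift j ew) jl).
Qed.

End Reversal.

(** The order on the classes is defined on tails without detours, where it is
    antisymmetric; the representatives are then cut once more, so that those
    which do not flow into each other do not reach each other at all.  The last
    cut is at an even index, which keeps the start at the minimal degree. *)
Lemma representative_rays_ex (disp : Order.disp_t) (P : porderType disp)
    (hP : graded P) (M : set (P * P)) (hM : morse_matching M)
    (hfin : finite_set (ray_classes (hasse_rev M))) :
  exists (rho : ray_classes (hasse_rev M) -> nat -> P)
         (rank : ray_classes (hasse_rev M) -> nat),
  [/\ forall R, [/\ ray (hasse_rev M) (rho R), val R = ray_class (hasse_rev M) (rho R),
                   low (rho R) & unavoidable (hasse_rev M) (rho R)]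
    & forall R S i j, reach (hasse_rev M) (rho R i) (rho S j) ->
                      R = S \/ rank S < rank R].
Proof.
have [mM ac] := hM; set e := hasse_rev M; pose I : choiceType := ray_classes e.
have shift_class r k : ray_class e (fun i => r (k + i)) = ray_class e r.
  exact/ray_class_equiv/ray_equiv_sym/ray_equiv_shift.
have /choice[r0 r0P] : forall R : I, exists r, [/\ walk e r,
    val R = ray_class e r, low r & unavoidable e r].
  move=> R; have [r [ri er] rR] := set_mem (valP R).
  have [N unN] := ray_unavoidable_tail ac hfin er.
  have [j [jl _]] := low_shift_ex (fun i => r (N + i)).
  exists (fun i => r (N + (j + i))); split => //.
  - exact: (walk_shift j (walk_shift N er)).
  - by rewrite (shift_class (fun i => r (N + i)) j) shift_class -rR.
  - exact: (@unavoidable_shift _ _ _ j unN).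
have [s sI] : exists s : seq I, forall R, R \in s.
  have /finite_seqP[s sE] := hfin; exists (pmap insub s) => R.
  have sub c : ray_classes e c -> c \in s by rewrite sE.
  by rewrite mem_pmap_sub; apply: sub; exact: set_mem (valP R).
have [||||rank rankP] := @finite_order_rank I s (fun R S => flows e (r0 R) (r0 S)) => //.
- by move=> R; exact: flows_refl.
- by move=> R S U; exact: flows_trans.
- move=> R S RS SR; apply: val_inj.
  have [eR -> _ uR] := r0P R; have [eS -> _ _] := r0P S.
  exact/ray_class_equiv/(flows_antisym eS uR RS SR).
have /choice[N NP] : forall R, exists N, forall S n, S \in s -> N <= n ->
    (exists j, reach e (r0 R n) (r0 S j)) -> flows e (r0 R) (r0 S).
  move=> R; apply: uniform_bound => S.
  have [RS|nRS] := pselect (flows e (r0 R) (r0 S)); first by exists 0.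
  have [n nn] : exists n, ~ exists j, reach e (r0 R n) (r0 S j).
    by apply: contrapT => H; apply: nRS => n; apply: contrapT => nn; apply: H; exists n.
  exists n => m nm [j mj]; case: nn; exists j.
  by apply: reach_trans mj; apply: walk_reach nm; have [] := r0P R.
exists (fun R i => r0 R ((N R).*2 + i)), rank; split=> [R|R S i j RS].
  have [eR RE lR uR] := r0P R; split=> /=.
  - by split; [apply: (@walk_inj _ e) => // |]; exact: walk_shift.
  - by rewrite shift_class.
  - exact: (low_shift hP mM (N R) eR lR).
  - exact: (@unavoidable_shift _ _ _ (N R).*2 uR).
apply: rankP; apply: (NP R S ((N R).*2 + i)) => //; first by lia.
by exists ((N S).*2 + j).
Qed.

Theorem theorem4p3 (disp : Order.disp_t) (P : porderType disp)
    (hP : graded P) (M' : set (P * P)) (hM' : morse_matching M')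
    (hfin : finite_set (ray_classes (hasse_rev M'))) :
  exists M : set (P * P),
    [/\ morse_matching M, rayless (hasse_rev M) &
      exists c : ray_classes (hasse_rev M') -> P,
        [/\ critical M = critical M' `|` range c,
            forall R : ray_classes (hasse_rev M'), ~ critical M' (c R),
            injective c &
            forall (R : ray_classes (hasse_rev M')) (r : nat -> P),
              val R r -> deg (c R) = ray_deg r]].
Proof.
have [rho [rank [rhoP rho_rank]]] := representative_rays_ex hP hM' hfin.
have [mM' ac] := hM'; set e := hasse_rev M' in rhoP rho_rank *.
have rho_walk R : walk e (rho R) by have [[]] := rhoP R.
have rho_low R : low (rho R) by have [] := rhoP R.
have rho_un R : unavoidable e (rho R) by have [] := rhoP R.
have rho_all w : walk e w -> exists R, ray_equiv w (rho R).
  move=> ew; have rw : ray e w by split=> //; exact: walk_inj ac ew.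
  have cw : ray_classes e (ray_class e w) by exists w.
  exists (SigSub (mem_set cw)); have [rR RE _ _] := rhoP (SigSub (mem_set cw)).
  apply: ray_equiv_sym.
  have : ray_class e (rho (SigSub (mem_set cw))) w.
    by rewrite -RE; split=> //; exact: ray_equiv_refl.
  by case.
have noW := reversal_no_walk hP mM' ac rho_walk rho_low rho_un rho_rank rho_all.
exists (reversal M' rho); split.
- split; first exact: reversal_matching hP mM' ac rho_walk rho_low rho_rank.
  exact: no_walk_acyclic.
- exact: no_walk_rayless.
exists (fun R => rho R 0); split.
- exact: reversal_critical hP mM' ac rho_walk rho_low rho_rank.
- move=> R cR; have [a [Ma av]] := rho_matched hP mM' rho_walk rho_low R 0.
  exact: cR Ma av.
- by move=> R S /(rho_eq ac rho_walk rho_rank)[].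
move=> R r Rr; have [rR RE lR _] := rhoP R.
have [[_ er] Rer] : ray_class e (rho R) r by rewrite -RE.
rewrite -(ray_deg_equiv hP mM' (rho_walk R) er Rer).
have [[j jE] min] := ray_degP (rho R).
by apply/eqP; rewrite eqn_leq min -jE lR.
Qed.
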